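(* Let $V=\coprod_{n\in\mathbb{N}}V_{(n)}$ be an $\mathbb{N}$-graded vertex algebra over $\mathbb{C}$ with $V_{(0)}=\mathbb{C}\mathbf{1}$ and let $U$ be a graded subspace of $V_+=\coprod_{n>0}V_{(n)}$; put $U_m=U\cap V_{(m)}$ for $m\ge1$. Then the following statements are equivalent: (a) $U$ generates $V$ as a vertex algebra, and for all $u\in U_m$, $v\in U_n$, $m,n\ge1$, $i\ge0$, the vector $u_iv$ is a linear combination of vectors $u^{(1)}_{-n_1}\cdots u^{(r)}_{-n_r}\mathbf{1}$ with $r\ge0$, $u^{(i)}\in U_{m_i}$, $n_i\ge1$ and $m_1+\cdots+m_r\le m+n-1$. (b) $U$ strongly generates $V$, i.e. $V=\mathrm{span}\{u^{(1)}_{-k_1}\cdots u^{(r)}_{-k_r}\mathbf{1}\mid r\ge0,\ u^{(i)}\in U,\ k_i\ge1\}$. (c) $V_+=U+C_1(V)$. (d) $U$ generates $V$ with PBW spanning property. Furthermore, assume that any one of the four equivalent conditions holds, and for $n\ge0$ let $E_n^U$ be the subspace of $V$ linearly spanned by the vectors $u^{(1)}_{-k_1}\cdots u^{(r)}_{-k_r}\mathbf{1}$ with $r\ge0$, $u^{(i)}\in U$ homogeneous, $k_i\ge1$ and $\mathrm{wt}\,u^{(1)}+\cdots+\mathrm{wt}\,u^{(r)}\le n$ (and $E_n^U=0$ for $n<0$). Then $E_U=\{E_n^U\}$ is a good filtration of the vertex algebra $V$, and for $n\ge0$, $$V_{(0)}+\cdots+V_{(n)}\subset E_n^U.$$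
   Context: Vertex algebra: a vector space $V$ over $\mathbb{C}$ with a linear map $Y:V\to\mathrm{Hom}(V,V((x)))$, $v\mapsto Y(v,x)=\sum_{n\in\mathbb{Z}}v_nx^{-n-1}$ ($v_n\in\mathrm{End}\,V$), and a vector $\mathbf{1}\in V$ such that $Y(\mathbf{1},x)=\mathrm{id}$; $Y(v,x)\mathbf{1}\in V[[x]]$ with $v_{-1}\mathbf{1}=v$ for $v\in V$; and for $u,v\in V$ the Jacobi identity holds: $$x_0^{-1}\delta\left(\tfrac{x_1-x_2}{x_0}\right)Y(u,x_1)Y(v,x_2)-x_0^{-1}\delta\left(\tfrac{x_2-x_1}{-x_0}\right)Y(v,x_2)Y(u,x_1)=x_2^{-1}\delta\left(\tfrac{x_1-x_0}{x_2}\right)Y(Y(u,x_0)v,x_2),$$ where $\delta(x)=\sum_{n\in\mathbb{Z}}x^n$ and powers of binomials are expanded in nonnegative powers of the second variable. $\mathbb{N}=\{0,1,2,\dots\}$. An $\mathbb{N}$-graded vertex algebra is a vertex algebra with a grading $V=\coprod_{n\in\mathbb{N}}V_{(n)}$ such that $u_mV_{(n)}\subset V_{(n+k-m-1)}$ for $u\in V_{(k)}$, $m\in\mathbb{Z}$ (with $V_{(j)}=0$ for $j<0$). For $v\in V_{(n)}$, $v$ is homogeneous of weight $\mathrm{wt}\,v=n$. A subspace $U$ is graded if $U=\coprod_n(U\cap V_{(n)})$. $U$ generates $V$ as a vertex algebra if $V=\mathrm{span}\{u^{(1)}_{n_1}\cdots u^{(r)}_{n_r}\mathbf{1}\mid r\ge0,u^{(i)}\in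 U,n_i\in\mathbb{Z}\}$. $C_1(V)$ is the subspace of $V_+$ linearly spanned by the vectors $u_{-1}v$ for $u,v\in V_+$ and the vectors $w_{-2}\mathbf{1}$ for $w\in V$. $U$ generates $V$ with PBW spanning property if for some basis $\{u^{(\alpha)}\mid\alpha\in I\}$ of $U$ and for any (total) order ``$>$'' on the set $\{u^{(\alpha)}_{-r}\mid\alpha\in I,\ r\ge1\}$, $V$ is linearly spanned by the vectors $u^{(\alpha_1)}_{-n_1}\cdots u^{(\alpha_r)}_{-n_r}\mathbf{1}$ with $r\ge0$, $\alpha_i\in I$, $n_i\ge1$ and $u^{(\alpha_1)}_{-n_1}\ge\cdots\ge u^{(\alpha_r)}_{-n_r}$. Good filtration of $V$: an increasing family of subspaces $\cdots\subset E_{-1}\subset E_0\subset E_1\subset\cdots$ ($n\in\mathbb{Z}$) with $\bigcup_{n\in\mathbb{Z}}E_n=V$, $\mathbf{1}\in E_0$, and for $u\in E_m$, $v\in E_n$: $u_jv\in E_{m+n}$ for $j<0$ and $u_jv\in E_{m+n-1}$ for $j\ge0$. *)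

(* Defs.v *)
From mathcomp Require Import all_boot all_order all_algebra.
From mathcomp Require Import boolp classical_sets fsbigop reals complex.

Set Implicit Arguments.
Unset Strict Implicit.
Unset Printing Implicit Defensive.

Import Order.TTheory GRing.Theory Num.Theory.

Local Open Scope classical_set_scope.
Local Open Scope complex_scope.
Local Open Scope ring_scope.

Section LinearAlgebra.
Variables (K : fieldType) (V : lmodType K).

Definition is_subspace (A : set V) : Prop :=
  A 0 /\ forall (a : K) (u v : V), A u -> A v -> A (a *: u + v).

Definition lspan (A : set V) : set V :=
  [set v | exists s : seq (K * V),
     (forall p, p \in s -> A p.2) /\ v = \sum_(p <- s) p.1 *: p.2].

Definition lin_indep (B : set V) : Prop :=
  forall (s : seq V) (c : V -> K), uniq s -> (forall x, x \in s -> B x) ->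
    \sum_(x <- s) c x *: x = 0 -> forall x, x \in s -> c x = 0.

Definition is_basis (B A : set V) : Prop := lin_indep B /\ lspan B = A.

(* [A] is the internal direct sum of the subspaces [W n], n in N. *)
Record is_coproduct (A : set V) (W : nat -> set V) : Prop := IsCoproduct {
  coproduct_subspace : forall n, is_subspace (W n);
  coproduct_sum : A = lspan (\bigcup_n W n);
  coproduct_indep : forall (N : nat) (f : nat -> V), (forall n, W n (f n)) ->
    \sum_(n < N) f n = 0 -> forall n, (n < N)%N -> f n = 0
}.

End LinearAlgebra.

(* n(n-1)...(n-i+1)/i! for an arbitrary integer n *)
Definition binomz (K : fieldType) (n : int) (i : nat) : K :=
  (\prod_(j < i) (n - j%:Z)%:~R) / i`!%:R.

(* [mode u n] is the operator u_n, the coefficient of x^(-n-1) in Y(u,x).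
   [va_jacobi] equates, on an arbitrary vector w, the coefficients of
   x0^(-l-1) x1^(-m-1) x2^(-n-1) on the two sides of the Jacobi identity,
   each binomial being expanded in nonnegative powers i of its second variable:
     x0^-1 delta((x1-x2)/x0)
       = sum_(l,i) (-1)^i C(l,i) x0^(-l-1) x1^(l-i) x2^i,
     x0^-1 delta((x2-x1)/(-x0))
       = sum_(l,i) (-1)^(l+i) C(l,i) x0^(-l-1) x2^(l-i) x1^i,
     x2^-1 delta((x1-x0)/x2)
       = sum_(k,i) (-1)^i C(k,i) x2^(-k-1) x1^(k-i) x0^i, with k = i-m-1
   (so the last coefficient is also C(m,i)).  By [mode_trunc] the three sums
   have finite support, hence [\sum_(i \in setT)] is their genuine value. *)
Record vertexAlgebra (R : realType) := VertexAlgebra {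
  va_sort :> lmodType R[i];
  mode : va_sort -> int -> va_sort -> va_sort;
  vac : va_sort;
  mode_linearl : forall (n : int) (v : va_sort), linear (fun u => mode u n v);
  mode_linearr : forall (u : va_sort) (n : int), linear (mode u n);
  mode_trunc : forall u v : va_sort,
    exists N : int, forall n : int, N <= n -> mode u n v = 0;
  mode_vac : forall (n : int) (v : va_sort),
    mode vac n v = if n == -1 then v else 0;
  mode_creation0 : forall (v : va_sort) (n : int), 0 <= n -> mode v n vac = 0;
  mode_creation : forall v : va_sort, mode v (-1) vac = v;
  va_jacobi : forall (u v w : va_sort) (l m n : int),
    \sum_(i \in [set: nat]) ((-1) ^+ i * binomz R[i] l i)
        *: mode u (l + m - i%:Z) (mode v (n + i%:Z) w)
    - \sum_(i \in [set: nat]) ((-1) ^ l * (-1) ^+ i * binomz R[i] l i)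
        *: mode v (l + n - i%:Z) (mode u (m + i%:Z) w)
    = \sum_(i \in [set: nat]) ((-1) ^+ i * binomz R[i] (i%:Z - m - 1) i)
        *: mode (mode u (l + i%:Z) v) (m + n - i%:Z) w
}.

Arguments vac {R _}.

Section VertexAlgebraTheory.
Variables (R : realType) (V : vertexAlgebra R).
Implicit Types (gr : nat -> set V) (U : set V).

Definition grZ gr (j : int) : set V :=
  match j with Posz n => gr n | Negz _ => [set 0] end.

Record is_grading gr : Prop := IsGrading {
  grading_coproduct : is_coproduct [set: V] gr;
  grading_mode : forall (k n : nat) (m : int) (u v : V), gr k u -> gr n v ->
    grZ gr (n%:Z + k%:Z - m - 1) (mode u m v)
}.

Definition Vplus gr : set V := lspan (\bigcup_(n in [set n | (0 < n)%N]) gr n).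

Definition graded_subspace gr U : Prop :=
  is_subspace U /\ is_coproduct U (fun n => U `&` gr n).

(* u1_(n1) ... ur_(nr) 1 *)
Definition monomial (w : seq (V * int)) : V :=
  foldr (fun p v => mode p.1 p.2 v) vac w.

(* u1_(-k1) ... ur_(-kr) 1 *)
Definition nmonomial (w : seq (V * nat)) : V :=
  monomial [seq (p.1, - p.2%:Z) | p <- w].

Definition generates U : Prop :=
  lspan [set monomial w | w in
           [set w : seq (V * int) | forall p, p \in w -> U p.1]] = [set: V].

Definition strongly_generates U : Prop :=
  lspan [set nmonomial w | w in
           [set w : seq (V * nat) |
              forall p, p \in w -> U p.1 /\ (1 <= p.2)%N]] = [set: V].

(* A letter ((u, k), m) stands for u_(-k) with u in [W m]: the weight m is
   recorded with the letter, and the total weight of a word is at most n. *)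
Definition weighted_span (W : nat -> set V) (n : nat) : set V :=
  lspan [set nmonomial [seq p.1 | p <- w] | w in
           [set w : seq (V * nat * nat) |
              (forall p, p \in w -> W p.2 p.1.1 /\ (1 <= p.1.2)%N) /\
              (\sum_(p <- w) p.2 <= n)%N]].

Definition graded_part gr U (m : nat) : set V :=
  [set u | (1 <= m)%N /\ U u /\ gr m u].

Definition generates_with_weight_bound gr U : Prop :=
  generates U /\
  forall (m n : nat) (u v : V) (i : nat),
    (1 <= m)%N -> (1 <= n)%N -> graded_part gr U m u -> graded_part gr U n v ->
    weighted_span (graded_part gr U) (m + n - 1)%N (mode u i%:Z v).

Definition C1 gr : set V :=
  lspan ([set x | exists u v : V, [/\ Vplus gr u, Vplus gr v & x = mode u (-1) v]]
         `|` [set x | exists w : V, x = mode w (-2) vac]).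

Definition total_order_on (T : Type) (D : set T) (ge : rel T) : Prop :=
  [/\ {in D &, total ge}, {in D &, antisymmetric ge}
    & {in D & &, transitive ge}].

(* The basis is indexed by its own elements, and the operators u_(-r) by the
   pairs (u, r) with u in the basis and r >= 1; [ge] orders these pairs. *)
Definition generates_PBW U : Prop :=
  exists2 B : set V, is_basis B U &
    let D := [set p : V * nat | B p.1 /\ (1 <= p.2)%N] in
    forall ge : rel (V * nat), total_order_on D ge ->
      lspan [set nmonomial w | w in
               [set w : seq (V * nat) |
                  (forall p, p \in w -> D p) /\ sorted ge w]] = [set: V].

Record good_filtration (E : int -> set V) : Prop := GoodFiltration {
  filtration_subspace : forall n, is_subspace (E n);
  filtration_incr : forall n, E n `<=` E (n + 1);
  filtration_exhaustive : \bigcup_n E n = [set: V];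
  filtration_vac : E 0 vac;
  filtration_neg : forall (m n j : int) (u v : V), E m u -> E n v ->
    j < 0 -> E (m + n) (mode u j v);
  filtration_nonneg : forall (m n j : int) (u v : V), E m u -> E n v ->
    0 <= j -> E (m + n - 1) (mode u j v)
}.

Definition EU gr U (n : int) : set V :=
  match n with
  | Posz n => weighted_span (fun m => U `&` gr m) n
  | Negz _ => [set 0]
  end.

End VertexAlgebraTheory.

(* Main.v *)
Require Import Defs.
From mathcomp Require Import all_boot all_order all_algebra.
From mathcomp Require Import boolp classical_sets reals complex.
From mathcomp Require Import fsbigop wochoice zify.

(* Write E_n for the span of the words u1_(-k1) ... ur_(-kr) 1 of total weight
   at most n in homogeneous elements of U.  By the commutator and iterate
   formulas, if u_i v lies in E_(m+n-1) for all generators u, v of weights m, n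
   with m + n <= N and all i >= 0, then the E_p satisfy the axioms of a good
   filtration up to total weight N.  Under (a) the brackets are controlled by
   hypothesis, so the union of the E_n is stable under all modes of U.  Under
   (c) one shows V_(n) <= E_n by induction on n: the brackets u_i v with
   m + n <= N have weight less than N, so the induction hypothesis makes E a
   filtration up to weight N, which absorbs a_(-1) b and w_(-2) 1.  Modulo
   E_(n-1) the letters of a word of weight n commute, so words can be sorted,
   which gives (d) for a homogeneous basis.  Finally (b) implies (c) because
   u_(-k-2) is proportional to (u_(-2) 1)_(-k-1). *)

Set Implicit Arguments.
Unset Strict Implicit.
Unset Printing Implicit Defensive.

Import Order.TTheory GRing.Theory Num.Theory.

Local Open Scope classical_set_scope.
Local Open Scope complex_scope.
Local Open Scope ring_scope.

(** * Subspaces and bases *)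

Section Subspaces.
Variables (K : fieldType) (V : lmodType K).
Implicit Types (A B H S T : set V) (W : nat -> set V).

Lemma subspace0 S : is_subspace S -> S 0.
Proof. by case. Qed.

Lemma subspaceD S u v : is_subspace S -> S u -> S v -> S (u + v).
Proof. by move=> [_ lin] Su Sv; rewrite -[u]scale1r; exact: lin. Qed.

Lemma subspaceZ S a u : is_subspace S -> S u -> S (a *: u).
Proof. by move=> [S0 lin] Su; rewrite -[a *: u]addr0; exact: lin. Qed.

Lemma subspaceB S u v : is_subspace S -> S u -> S v -> S (u - v).
Proof.
by move=> sS Su Sv; apply: subspaceD => //; rewrite -scaleN1r; exact: subspaceZ.
Qed.

Lemma subspace_sum S (I : Type) (r : seq I) (P : pred I) (F : I -> V) :
  is_subspace S -> (forall i, P i -> S (F i)) -> S (\sum_(i <- r | P i) F i).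
Proof.
by move=> sS SF; apply: (big_ind S) => //;
  [exact: subspace0|move=> *; exact: subspaceD].
Qed.

Lemma subspace_fsum S (F : nat -> V) :
  is_subspace S -> (forall i, S (F i)) -> S (\sum_(i \in [set: nat]) F i).
Proof. by move=> sS SF; exact: subspace_sum. Qed.

Lemma fsum_single (F : nat -> V) k :
  (forall i, i <> k -> F i = 0) -> \sum_(i \in [set: nat]) F i = F k.
Proof.
move=> F0; rewrite -(fsbig_widen [set k]) ?fsbig_set1 //.
by move=> i [_ /= /F0].
Qed.

Lemma subspace_preimage (V' : lmodType K) (f : V' -> V) S :
  linear f -> is_subspace S -> is_subspace (f @^-1` S).
Proof.
move=> lf sS; have f0 : f 0 = 0.
  by have := lf (-1) 0 0; rewrite scaler0 addr0 scaleN1r addNr.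
split=> [|a u v] /=; first by rewrite f0; exact: subspace0.
by rewrite lf => Su Sv; case: sS => _; exact.
Qed.

Lemma subspace_set0 : is_subspace [set (0 : V)].
Proof. by split=> // a u v /= -> ->; rewrite scaler0 addr0. Qed.

Lemma lspan_subspace A : is_subspace (lspan A).
Proof.
split; first by exists [::]; rewrite big_nil.
move=> a _ _ [s [sA ->]] [t [tA ->]].
exists ([seq (a * p.1, p.2) | p <- s] ++ t); split.
  move=> p; rewrite mem_cat => /orP[/mapP[q qs ->]|/tA//].
  exact: sA qs.
rewrite big_cat big_map scaler_sumr; congr (_ + _).
by apply: eq_bigr => p _; rewrite scalerA.
Qed.

Lemma sub_lspan A : A `<=` lspan A.
Proof.
move=> u Au; exists [:: (1, u)]; split; last by rewrite big_seq1 scale1r.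
by move=> p; rewrite inE => /eqP ->.
Qed.

Lemma lspan_min A S : is_subspace S -> A `<=` S -> lspan A `<=` S.
Proof.
move=> sS AS _ [s [sA ->]]; rewrite big_seq; apply: subspace_sum => // p ps.
by apply: subspaceZ => //; apply/AS/sA.
Qed.

Lemma lspan_mono A B : A `<=` B -> lspan A `<=` lspan B.
Proof.
by move=> AB; apply: lspan_min; [exact: lspan_subspace|move=> x /AB /sub_lspan].
Qed.

(** Padding by zero components makes the sum valid for every length [M] beyond [N], so that two
    representations can be added or compared at a common length. *)
Lemma lspan_bigcup_sum W x : (forall n, is_subspace (W n)) ->
  lspan (\bigcup_n W n) x ->
  exists N f, (forall n, W n (f n)) /\
    forall M, (N <= M)%N -> x = \sum_(n < M) f n.
Proof.
move=> sW; move: x.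
pose Q := [set x : V | exists (N : nat) (f : nat -> V), (forall n, W n (f n)) /\
    forall M, (N <= M)%N -> x = \sum_(n < M) f n].
apply: (@lspan_min _ Q).
- split.
    exists 0%N, (fun=> 0); split=> [n|M _]; first exact: subspace0.
    by rewrite big1.
  move=> a u v [N [f [Wf uf]]] [N' [f' [Wf' vf']]].
  exists (maxn N N'), (fun n => a *: f n + f' n); split=> [n|M].
    by case: (sW n) => _; apply.
  rewrite geq_max => /andP[NM NM'].
  by rewrite big_split -scaler_sumr -uf // -vf'.
- move=> x [k _ Wx]; exists k.+1, (fun n => if n == k then x else 0).
  split=> [n|M kM]; first by case: eqP => [->//|_]; exact: subspace0.
  by rewrite -big_mkcond (big_pred1 (Ordinal kM)).
Qed.

(** The components of [x] in the [A k], with [x] subtracted in degree [n], are homogeneous vectors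
    with zero sum, so independence makes each of them vanish. This serves in place of projections
    onto homogeneous components. *)
Lemma component_mem T W (A : nat -> set V) n x : is_coproduct T W ->
  (forall k, is_subspace (A k)) -> (forall k, A k `<=` W k) ->
  W n x -> lspan (\bigcup_k A k) x -> A n x.
Proof.
move=> cW sA AW Wx /(lspan_bigcup_sum sA)[N [f [Af xf]]].
pose g k := f k - (if k == n then x else 0).
have Wg k : W k (g k).
  apply: subspaceB; [exact: coproduct_subspace cW k|exact/AW/Af|].
  by case: eqP => [->//|_]; exact: subspace0 (coproduct_subspace cW k).
pose M := maxn N n.+1.
have nM : (n < M)%N by rewrite leq_max leqnn orbT.
have g0 : \sum_(k < M) g k = 0.
  rewrite sumrB -xf ?leq_maxl// -big_mkcond (big_pred1 (Ordinal nM)) //.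
  by rewrite subrr.
have /eqP := coproduct_indep cW Wg g0 nM.
by rewrite /g eqxx subr_eq0 => /eqP <-.
Qed.

(** Zorn's lemma on the independent subsets of [H]: a maximal one spans, since adjoining a vector
    outside its span would keep it independent. *)
Lemma exists_basis H :
  exists B, [/\ B `<=` H, lin_indep B & H `<=` lspan B].
Proof.
have [|B [[BH iB] maxB]] := @Zorn_bigcup V [set B | B `<=` H /\ lin_indep B].
  move=> F FP totF; split; first by move=> x [X FX] /(FP _ FX).1.
  move=> s c us sF.
  (* Finitely many vectors in the union of a chain lie in a single member. The empty set is allowed
     because the chain itself may be empty. *)
  have [X FX sX] : exists2 X, F X \/ X = set0 & forall x, x \in s -> X x.
  - elim: s us sF {c} => [_ _|x s IH /= /andP[_ us] sF].
      by exists set0; [right|].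
    have [|X FX sX] := IH us; first by move=> y ys; apply: sF; rewrite inE ys orbT.
    have [Y FY Yx] := sF x (mem_head _ _).
    case: FX => [FX|X0].
      have [YX|XY] := totF _ _ FY FX; [exists X|exists Y]; try by left.
        by move=> y; rewrite inE => /orP[/eqP ->|/sX//]; exact: YX.
      by move=> y; rewrite inE => /orP[/eqP ->//|/sX]; exact: XY.
    exists Y; first by left.
    by move=> y; rewrite inE => /orP[/eqP ->//|/sX]; rewrite X0.
  case: FX => [FX|X0] s0 x xs; first exact: (FP _ FX).2 s0 x xs.
  by have := sX x xs; rewrite X0.
exists B; split=> // h Hh; apply: contrapT => hB.
have Bh : ~ B h by move/sub_lspan.
apply: (maxB (B `|` [set h])).
  split; first by move=> x; left.
  by move/(_ h (or_intror erefl)).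
split=> [x [/BH//|->//]|s c us sB].
have sBh x : x \in s -> x != h -> B x.
  by move=> /sB[//|/= ->]; rewrite eqxx.
have [hs|hs] := boolP (h \in s); last first.
  move=> s0; apply: iB s0 => // x xs; apply: sBh => //.
  by apply: contraNneq hs => <-.
rewrite (big_rem h) //= => s0.
have rB x : x \in rem h s -> B x.
  by rewrite mem_rem_uniq // inE => /andP[xh xs]; exact: sBh.
have ch : c h = 0.
  apply: contrapT => /eqP ch; apply: hB.
  move/eqP: s0; rewrite addr_eq0 => /eqP s0.
  rewrite -[h]scale1r -(mulVf ch) -scalerA s0.
  apply: subspaceZ; first exact: lspan_subspace.
  rewrite -scaleN1r; apply: subspaceZ; first exact: lspan_subspace.
  rewrite big_seq; apply: subspace_sum; first exact: lspan_subspace.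
  by move=> x xs; apply: subspaceZ; [exact: lspan_subspace|exact/sub_lspan/rB].
move: s0; rewrite ch scale0r add0r => s0 x xs.
have [->//|xh] := eqVneq x h.
by apply: (iB (rem h s) c _ rB s0); rewrite ?rem_uniq // mem_rem_uniq // inE xh.
Qed.

End Subspaces.

(** The PBW property speaks of all orders, so drawing a spanning set from it requires that one
    exists; a well-ordering provides it. *)
Lemma exists_total_order (T : eqType) (D : set T) :
  exists ge : rel T, total_order_on D ge.
Proof.
have [R woR] := well_ordering_principle T.
have woT : wo_chain R (@predT T) by move=> A _; exact: woR.
have tR x y : R x y || R y x by apply: (wo_chainW woT).
have aR x y : R x y -> R y x -> x = y.
  by move=> Rxy Ryx; apply: (wo_chain_antisymmetric woT) => //; rewrite Rxy.
exists R; split=> [x y _ _|x y _ _ /andP[]|y x z _ _ _ Rxy Ryz] //.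
  exact: aR.
(* Transitivity is read off the least element of x, y, z, directly or through antisymmetry. *)
have [t [tP mt]] : exists t, minimum_of R (mem [:: x; y; z]) t.
  have [|t [mt _]] := woR (mem [:: x; y; z]); last by exists t.
  by exists x; exact: mem_head.
have [tx ty tz] : [/\ R t x, R t y & R t z].
  by split; apply: mt; rewrite !inE eqxx ?orbT.
move: tP tx ty tz; rewrite !inE => /or3P[] /eqP -> // tx ty tz.
  by rewrite (aR _ _ Rxy tx).
by rewrite -(aR _ _ Ryz ty).
Qed.

(** * Consequences of the Jacobi identity *)

Section Modes.
Variables (R : realType) (V : vertexAlgebra R).
Implicit Types (u v w : V) (S : set V).

Lemma mode0r u n : mode u n (0 : V) = 0.
Proof. exact: (subspace0 (subspace_preimage (mode_linearr u n) (subspace_set0 V))). Qed.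

Lemma mode0l n v : mode (0 : V) n v = 0.
Proof. exact: (subspace0 (subspace_preimage (mode_linearl n v) (subspace_set0 V))). Qed.

Lemma modeBr u n v w : mode u n (v - w) = mode u n v - mode u n w.
Proof.
by rewrite addrC -scaleN1r (mode_linearr u n) scaleN1r addrC.
Qed.

Lemma binomz_n0 (K : fieldType) n : binomz K n 0 = 1.
Proof. by rewrite /binomz big_ord0 fact0 divr1. Qed.

Lemma binomz_eq0 (K : fieldType) (n i : nat) : (n < i)%N -> binomz K n%:Z i = 0.
Proof. by move=> ni; rewrite /binomz (bigD1 (Ordinal ni)) //= subrr !mul0r. Qed.

(** The Jacobi identity with l = 0: C(0,i) vanishes for i > 0, which leaves the commutator formula.
    Stated as membership in a subspace, it hides the coefficients. *)
Lemma commutator_mem S u v w (m n : int) : is_subspace S ->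
  (forall i : nat, S (mode (mode u i%:Z v) (m + n - i%:Z) w)) ->
  S (mode u m (mode v n w) - mode v n (mode u m w)).
Proof.
move=> sS SF; have := va_jacobi u v w 0 m n.
rewrite (@fsum_single _ _ _ 0%N) => [|[|i] // _]; last by rewrite binomz_eq0 // mulr0 scale0r.
rewrite (@fsum_single _ _ _ 0%N) => [|[|i] // _]; last by rewrite binomz_eq0 // mulr0 scale0r.
rewrite !binomz_n0 ?expr0 ?mulr1 !scale1r (_ : Posz 0 = 0) // !subr0 ?addr0 !add0r => ->.
apply: subspace_fsum => // i; apply: subspaceZ => //.
by rewrite add0r.
Qed.

(** The Jacobi identity with m = 0: on the right C(i-1,i) vanishes for i > 0, so only (u_l v)_n w
    remains. *)
Lemma jacobi_iterate u v w (l n : int) :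
  mode (mode u l v) n w =
    \sum_(i \in [set: nat]) ((-1) ^+ i * binomz R[i] l i)
        *: mode u (l - i%:Z) (mode v (n + i%:Z) w)
    - \sum_(i \in [set: nat]) ((-1) ^ l * (-1) ^+ i * binomz R[i] l i)
        *: mode v (l + n - i%:Z) (mode u i%:Z w).
Proof.
have := va_jacobi u v w l 0 n.
rewrite [RHS](@fsum_single _ _ _ 0%N) => [|[|i] // _]; last first.
  by rewrite (_ : i.+1%:Z - 0 - 1 = i%:Z) ?binomz_eq0 ?mulr0 ?scale0r //; lia.
rewrite binomz_n0 expr0 mulr1 scale1r (_ : Posz 0 = 0) // ?subr0 ?addr0 ?add0r => <-.
by congr (_ - _); apply: eq_fsbigr => i _; rewrite ?addr0 ?add0r.
Qed.

Lemma iterate_mem S u v w (l n : int) : is_subspace S ->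
  (forall i : nat, S (mode u (l - i%:Z) (mode v (n + i%:Z) w))) ->
  (forall i : nat, S (mode v (l + n - i%:Z) (mode u i%:Z w))) ->
  S (mode (mode u l v) n w).
Proof.
move=> sS Suv Svu; rewrite jacobi_iterate.
by apply: subspaceB => //; apply: subspace_fsum => // i; apply: subspaceZ.
Qed.

(* The mode form of Y(L(-1)u, x) = d/dx Y(u, x), with L(-1)u = u_(-2) 1. *)
Lemma mode_derivation u w (k : nat) : exists c : R[i],
  mode u (- k.+2%:Z) w = c *: mode (mode u (-2) vac) (- k.+1%:Z) w.
Proof.
have := jacobi_iterate u vac w (-2) (- k.+1%:Z).
(* Since 1_j is nonzero only for j = -1, the first sum reduces to i = k and the second vanishes. The
   remaining coefficient (-1)^k C(-2,k) is invertible in characteristic 0. *)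
rewrite (@fsum_single _ _ _ k) => [|i ik]; last first.
  by rewrite mode_vac ifF ?mode0r ?scaler0 //; apply/negbTE/eqP; lia.
rewrite fsbig1 => [|i _]; last first.
  by rewrite mode_vac ifF ?scaler0 //; apply/negbTE/eqP; lia.
rewrite subr0 mode_vac ifT; last by apply/eqP; lia.
rewrite (_ : -2 - k%:Z = - k.+2%:Z); last by lia.
set c := _ * _ => ->; exists c^-1; rewrite scalerA mulVf ?scale1r //.
rewrite mulf_neq0 ?expf_neq0 ?oppr_eq0 ?oner_eq0 // mulf_neq0 //.
  apply/prodf_neq0 => j _; rewrite intr_eq0; lia.
by rewrite invr_eq0 pnatr_eq0 -lt0n fact_gt0.
Qed.

End Modes.

(** * Spans of words of bounded weight *)

Section WordSpans.
Variables (R : realType) (V : vertexAlgebra R).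
Implicit Types (u v w x : V) (S : set V) (W : nat -> set V).

Definition is_word W (s : seq (V * nat * nat)) : Prop :=
  forall p, p \in s -> W p.2 p.1.1 /\ (1 <= p.1.2)%N.

(* The bound on the weight is strict, so [weighted_span W n] is
   [word_span W n.+1], and [word_span W 0] plays the role of E_(-1) = 0. *)
Definition word_span W (n : nat) : set V :=
  lspan [set nmonomial [seq p.1 | p <- s] | s in
           [set s | is_word W s /\ (\sum_(p <- s) p.2 < n)%N]].

Lemma weighted_spanE W n : weighted_span W n = word_span W n.+1.
Proof. by []. Qed.

Lemma is_word_cons W p s :
  is_word W (p :: s) <-> (W p.2 p.1.1 /\ (1 <= p.1.2)%N) /\ is_word W s.
Proof.
split=> [ws|[pW ws] q]; last by rewrite inE => /orP[/eqP ->|/ws].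
by split=> [|q qs]; apply: ws; rewrite inE ?eqxx // qs orbT.
Qed.

Lemma word_span_subspace W n : is_subspace (word_span W n).
Proof. exact: lspan_subspace. Qed.

Lemma word_span_word W s n : is_word W s -> (\sum_(p <- s) p.2 < n)%N ->
  word_span W n (nmonomial [seq p.1 | p <- s]).
Proof. by move=> ws sn; apply: sub_lspan; exists s. Qed.

Lemma word_span_le W m n : (m <= n)%N -> word_span W m `<=` word_span W n.
Proof.
move=> mn; apply: lspan_mono => _ [s [ws sm] <-].
by exists s => //; split=> //; exact: leq_trans mn.
Qed.

Lemma word_span_vac W n : word_span W n.+1 vac.
Proof. by apply: (@word_span_word W [::]); rewrite ?big_nil. Qed.

Lemma word_span_cons W m n k u x : W m u -> (1 <= k)%N ->
  word_span W n x -> word_span W (m + n) (mode u (- k%:Z) x).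
Proof.
move=> Wu k1; move: x.
apply: (lspan_min (S := mode u (- k%:Z) @^-1` word_span W (m + n))).
  exact: subspace_preimage (mode_linearr _ _) (word_span_subspace _ _).
move=> _ [s [ws sn] <-] /=.
apply: (@word_span_word W ((u, k, m) :: s)); last by rewrite big_cons ltn_add2l.
by apply/is_word_cons.
Qed.

Lemma word_span_letter W m u : W m u -> word_span W m.+1 u.
Proof.
move=> Wu; rewrite -addn1 -[u]mode_creation.
by apply: (@word_span_cons W m 1 1) => //; exact: word_span_vac.
Qed.

(** Induction on the first letter, with the tail relaxed from a word to any vector of the smaller
    span, so that filtration estimates apply to it. *)
Lemma word_span_min W n S : is_subspace S -> ((0 < n)%N -> S vac) ->
  (forall m u k x, (m < n)%N -> W m u -> (1 <= k)%N ->
    word_span W (n - m) x -> S (mode u (- k%:Z) x)) ->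
  word_span W n `<=` S.
Proof.
move=> sS Svac Sc; apply: lspan_min => // _ [[|[[u k] m] s] [ws sn] <-].
  by apply: Svac; rewrite big_nil in sn.
have /is_word_cons[/= [Wu k1] {}ws] := ws; rewrite big_cons /= in sn.
apply: (Sc m) => //; first by lia.
by apply: word_span_word => //; rewrite ltn_subRL.
Qed.

(** Words are multilinear in their letters. This is how letters are later restricted to positive
    weights and to basis vectors. *)
Lemma word_span_letters W W' n :
  (forall m u, W m u -> lspan (W' m) u) -> word_span W n `<=` word_span W' n.
Proof.
move=> WW'; apply: lspan_min; first exact: word_span_subspace.
move=> _ [s [ws sn] <-]; apply: word_span_le sn _ _.
elim: s ws => [|[[u k] m] s IH] ws; first exact: word_span_vac.
have /is_word_cons[/= [/WW' Wu k1] /IH{}ws] := ws.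
rewrite big_cons -addnS; move: u Wu {IH}.
apply: (lspan_min (S := (fun u => mode u (- k%:Z) _) @^-1` word_span W' _)).
  exact: subspace_preimage (mode_linearl _ _) (word_span_subspace _ _).
by move=> u Wu; exact: word_span_cons.
Qed.

(** Strong induction on p + q. As bounds are strict, the term [(j < 0)] says that negative modes
    preserve the filtration degree and the others lower it by one. Brackets are controlled only up
    to total weight [N], so the lemma can be used inside an induction on the weight. *)
Lemma word_span_mode W N :
  (forall m u, W m u -> (0 < m)%N) ->
  (forall m n u v (i : nat), (m + n <= N)%N -> W m u -> W n v ->
    word_span W (m + n) (mode u i%:Z v)) ->
  forall p q a b (j : int), (p + q <= N)%N ->
    word_span W p.+1 a -> word_span W q.+1 b ->
    word_span W (p + q + (j < 0)%R) (mode a j b).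
Proof.
move=> W0 WW p q; have [M] := ubnP (p + q).
elim: M p q => // M IH p q; rewrite ltnS => pqM a b j pqN Ea Eb.
(* First a single letter u with a mode i >= 0. Moving u_i past the first letter v of b leaves a
   commutator in brackets u_l v, which have already lost one degree; on the vacuum u_i gives 0. *)
have generator m u (i : nat) : W m u -> (m + q <= p + q)%N ->
    word_span W (m + q) (mode u i%:Z b).
  move=> Wu mq; have m0 := W0 _ _ Wu; move: b Eb.
  apply: (word_span_min (S := mode u i%:Z @^-1` word_span W (m + q))).
  - exact: subspace_preimage (mode_linearr _ _) (word_span_subspace _ _).
  - move=> _ /=; rewrite mode_creation0 //.
    exact: subspace0 (word_span_subspace _ _).
  move=> n v k b nq Wv k1; rewrite subSn // => Eb /=; have n0 := W0 _ _ Wv.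
  rewrite -[mode u _ _](subrK (mode v (- k%:Z) (mode u i%:Z b))).
  apply: subspaceD; first exact: word_span_subspace.
    apply: commutator_mem => [|l]; first exact: word_span_subspace.
    have Euv : word_span W (m + n).-1.+1 (mode u l%:Z v).
      by rewrite prednK; [apply: WW => //; lia|lia].
    apply: (word_span_le _ (IH _ _ _ _ _ _ _ Euv Eb)); lia.
  have -> : (m + q = n + (m + (q - n)))%N by lia.
  apply: word_span_cons => //.
  have := IH m (q - n)%N _ u b i%:Z _ (word_span_letter Wu) Eb.
  by rewrite addn0; apply; lia.
move: a Ea.
apply: (word_span_min (S := (fun a => mode a j b) @^-1` word_span W _)).
- exact: subspace_preimage (mode_linearl _ _) (word_span_subspace _ _).
- move=> _ /=; rewrite mode_vac; case: eqP => [->|_].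
    by apply: (word_span_le _ Eb); lia.
  exact: subspace0 (word_span_subspace _ _).
move=> m u k a mp Wu k1; rewrite subSn // => Ea /=; have m0 := W0 _ _ Wu.
(* In the iterate formula for (u_(-k) a)_j b, either u stands in front as a letter, or u_i b appears
   with i >= 0, and the degree lost there pays for a possibly negative mode of a. *)
apply: iterate_mem => [|i|i]; first exact: word_span_subspace.
  have -> : - k%:Z - i%:Z = - (k + i)%N%:Z by lia.
  have -> : (p + q + (j < 0)%R = m + (p - m + q + (j < 0)%R))%N by lia.
  apply: word_span_cons => //; first by lia.
  apply: (word_span_le _ (IH _ _ _ _ _ (j + i%:Z) _ Ea Eb)); lia.
have Eub : word_span W (m + q).-1.+1 (mode u i%:Z b).
  by rewrite prednK; [apply: generator => //; lia|lia].
apply: (word_span_le _ (IH _ _ _ _ _ _ _ Ea Eub)); lia.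
Qed.

(** The commutator consists of modes of brackets u_i v of degree at most m + n - 1, so the result
    has degree at most m + n + d - 1 even when those modes are negative. *)
Lemma word_span_swap W :
  (forall m u, W m u -> (0 < m)%N) ->
  (forall m n u v (i : nat), W m u -> W n v ->
    word_span W (m + n) (mode u i%:Z v)) ->
  forall m n d u v x (k l : int), W m u -> W n v -> word_span W d.+1 x ->
    word_span W (m + n + d) (mode u k (mode v l x) - mode v l (mode u k x)).
Proof.
move=> W0 WW m n d u v x k l Wu Wv Ex.
have m0 := W0 _ _ Wu; apply: commutator_mem => [|i]; first exact: word_span_subspace.
have Euv : word_span W (m + n).-1.+1 (mode u i%:Z v).
  by rewrite prednK; [exact: WW|lia].
have := word_span_mode W0 (fun m n u v i _ => WW m n u v i) (k + l - i%:Z)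
  (leqnn _) Euv Ex.
apply: word_span_le; lia.
Qed.

(** The bound being strict, the difference has lower degree than the words: letters commute in the
    associated graded space. *)
Lemma word_span_perm W :
  (forall m u, W m u -> (0 < m)%N) ->
  (forall m n u v (i : nat), W m u -> W n v ->
    word_span W (m + n) (mode u i%:Z v)) ->
  forall s t, perm_eq s t -> is_word W s ->
    word_span W (\sum_(p <- s) p.2)
      (nmonomial [seq p.1 | p <- s] - nmonomial [seq p.1 | p <- t]).
Proof.
move=> W0 WW; elim=> [|[[u k] m] s IH] t st ws.
  have /perm_nilP -> : perm_eq t [::] by rewrite perm_sym.
  by rewrite subrr; exact: subspace0 (word_span_subspace _ _).
have ut : (u, k, m) \in t by rewrite -(perm_mem st) mem_head.
case/splitPr: ut st => t1 t2 st.
have {}st : perm_eq s (t1 ++ t2).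
  by rewrite -(perm_cons (u, k, m)) (perm_trans st) // perm_catC /= perm_cons perm_catC.
have /is_word_cons[/= [Wu k1] {}ws] := ws.
have wt : is_word W (t1 ++ t2) by move=> p; rewrite -(perm_mem st); exact: ws.
rewrite big_cons /=.
(* First the tail is rearranged behind the head letter, then the head letter is moved through [t1]
   by successive swaps. *)
rewrite -(subrKA (mode u (- k%:Z) (nmonomial [seq p.1 | p <- t1 ++ t2]))).
apply: subspaceD; first exact: word_span_subspace.
  by rewrite -modeBr; apply: word_span_cons => //; exact: IH.
rewrite (perm_big _ st) /=.
elim: t1 wt {IH st ws s} => [|[[v l] n] t1 IH] wt.
  by rewrite subrr; exact: subspace0 (word_span_subspace _ _).
have /is_word_cons[/= [Wv l1] {}wt] := wt; rewrite big_cons /=.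
rewrite -(subrKA (mode v (- l%:Z) (mode u (- k%:Z) (nmonomial [seq p.1 | p <- t1 ++ t2])))).
apply: subspaceD; first exact: word_span_subspace.
  rewrite addnA; apply: word_span_swap => //.
  exact: word_span_word.
by rewrite -modeBr addnCA; apply: word_span_cons => //; exact: IH.
Qed.

End WordSpans.

(** * The equivalences *)

Section Equivalences.
Variables (R : realType) (V : vertexAlgebra R) (gr : nat -> set V).
Hypothesis Hgr : is_grading gr.
Hypothesis Hgr0 : gr 0%N = [set c *: (vac : V) | c in [set: R[i]]].
Variable U : set V.
Hypothesis HUgr : graded_subspace gr U.
Hypothesis HUplus : U `<=` Vplus gr.
Implicit Types (u v w x : V).

Local Notation W := (graded_part gr U).

Let coV : is_coproduct [set: V] gr := grading_coproduct Hgr.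

Let gr_subspace n : is_subspace (gr n) := coproduct_subspace coV n.

Let U_subspace : is_subspace U := HUgr.1.

Let U_sum : U = lspan (\bigcup_n (U `&` gr n)) := coproduct_sum HUgr.2.

Let V_sum x : lspan (\bigcup_n gr n) x.
Proof. by rewrite -(coproduct_sum coV). Qed.

(** * The subspaces V_+ and C_1(V) *)

Lemma gr_mode k n (m : int) (j : nat) u v : gr k u -> gr n v ->
  n%:Z + k%:Z - m - 1 = j%:Z -> gr j (mode u m v).
Proof. by move=> gu gv e; have := grading_mode Hgr m gu gv; rewrite e. Qed.

Lemma Vplus_subspace : is_subspace (Vplus gr).
Proof. exact: lspan_subspace. Qed.

Lemma Vplus_gr n x : (0 < n)%N -> gr n x -> Vplus gr x.
Proof. by move=> n0 gx; apply: sub_lspan; exists n. Qed.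

Lemma Vplus_gr0 x : gr 0%N x -> Vplus gr x -> x = 0.
Proof.
(* The grading with its weight 0 piece replaced by 0 still spans V_+. *)
move=> gx Vx; pose A n : set V := if n is 0 then [set 0] else gr n.
apply: (component_mem (A := A) coV _ _ gx).
- by case=> [|n]; [exact: subspace_set0|exact: gr_subspace].
- by case=> [|n] //= y ->; exact: subspace0.
- by apply: lspan_mono Vx => y [[|n] // _ gy]; exists n.+1.
Qed.

Lemma vac_Vplus_decomposition x :
  exists c y, Vplus gr y /\ x = c *: vac + y.
Proof.
move: x (V_sum x).
apply: (lspan_min (S := [set x | exists c y, Vplus gr y /\ x = c *: vac + y])).
  split.
    exists 0, 0; split; last by rewrite scale0r addr0.
    exact: subspace0 Vplus_subspace.
  move=> a _ _ [c [y [Vy ->]]] [d [z [Vz ->]]].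
  exists (a * c + d), (a *: y + z); split.
    by case: Vplus_subspace => _; apply.
  by rewrite scalerDl scalerDr scalerA addrACA.
move=> x [[|n] _ gx].
  move: gx; rewrite Hgr0 => -[c _ <-]; exists c, 0; rewrite addr0; split=> //.
  exact: subspace0 Vplus_subspace.
by exists 0, x; rewrite scale0r add0r; split=> //; exact: Vplus_gr gx.
Qed.

Lemma Vplus_mode (m : int) u v : m < 0 -> Vplus gr u -> Vplus gr v -> Vplus gr (mode u m v).
Proof.
move=> m0 Vu; move: v.
apply: (lspan_min (S := mode u m @^-1` Vplus gr)).
  exact: subspace_preimage (mode_linearr _ _) Vplus_subspace.
move=> v [q /= q0 gv]; move: u Vu.
apply: (lspan_min (S := (fun u => mode u m v) @^-1` Vplus gr)).
  exact: subspace_preimage (mode_linearl _ _) Vplus_subspace.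
move=> u [p /= p0 gu].
apply: (@Vplus_gr (absz (q%:Z + p%:Z - m - 1)%R)); last apply: gr_mode gu gv _; lia.
Qed.

Lemma vac_gr : gr 0%N vac.
Proof. by rewrite Hgr0; exists 1 => //; rewrite scale1r. Qed.

Lemma Vplus_derivation w : Vplus gr (mode w (-2) vac).
Proof.
move: w (V_sum w).
apply: (lspan_min (S := (fun w => mode w (-2) vac) @^-1` Vplus gr)).
  exact: subspace_preimage (mode_linearl _ _) Vplus_subspace.
move=> w [k _ gw]; apply: (@Vplus_gr k.+1) => //.
apply: gr_mode gw vac_gr _; lia.
Qed.

Lemma C1_subspace : is_subspace (C1 gr).
Proof. exact: lspan_subspace. Qed.

Lemma C1_Vplus : C1 gr `<=` Vplus gr.
Proof.
apply: lspan_min; first exact: Vplus_subspace.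
move=> _ [[u [v [Vu Vv ->]]]|[w ->]]; last exact: Vplus_derivation.
exact: Vplus_mode.
Qed.

(** As u_(-k-2) is a multiple of (u_(-2) 1)_(-k-1), and u_(-2) 1 lies in V_+, induction on k reduces
    to u_(-1) v. *)
Lemma C1_mode (k : nat) u v : Vplus gr u -> Vplus gr v ->
  C1 gr (mode u (- k.+1%:Z) v).
Proof.
move=> + Vv; elim: k u => [|k IH] u Vu.
  by apply: sub_lspan; left; exists u, v.
have [c ->] := mode_derivation u v k; apply: subspaceZ; first exact: C1_subspace.
exact/IH/Vplus_derivation.
Qed.

Lemma C1_mode_vac (k : nat) u : C1 gr (mode u (- k.+2%:Z) vac).
Proof.
elim: k u => [|k IH] u; first by apply: sub_lspan; right; exists u.
have [c ->] := mode_derivation u vac k.+1.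
by apply: subspaceZ; first exact: C1_subspace.
Qed.

(** * Homogeneous letters from U and the inclusion of V_(n) in E_n *)

Lemma graded_part_gt0 m u : W m u -> (0 < m)%N.
Proof. by case. Qed.

Lemma U_gr0 u : U u -> gr 0%N u -> u = 0.
Proof. by move=> /HUplus Vu gu; exact: Vplus_gr0. Qed.

Lemma U_span : U = lspan (\bigcup_n W n).
Proof.
apply/seteqP; split; last first.
  by apply: lspan_min => // u [n _ [_ []]].
rewrite {1}U_sum; apply: lspan_min; first exact: lspan_subspace.
move=> u [[|n] _ [Uu gu]]; last by apply: sub_lspan; exists n.+1.
by rewrite (U_gr0 Uu gu); exact: subspace0 (lspan_subspace _).
Qed.

Lemma EU_word_span (n : nat) : EU gr U n%:Z = word_span W n.+1.
Proof.
rewrite /EU weighted_spanE; apply/seteqP; split; apply: word_span_letters => m u.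
  case: m => [|m] [Uu gu]; last by apply: sub_lspan; split.
  by rewrite (U_gr0 Uu gu); exact: subspace0 (lspan_subspace _).
by case=> _ ?; exact: sub_lspan.
Qed.

Lemma word_span_union_subspace : is_subspace [set x | exists n, word_span W n x].
Proof.
split; first by exists 0%N; exact: subspace0 (word_span_subspace _ _).
move=> a u v [m Eu] [n Ev]; exists (maxn m n).
apply: subspaceD; first exact: word_span_subspace.
  apply: subspaceZ; first exact: word_span_subspace.
  by apply: word_span_le Eu; exact: leq_maxl.
by apply: word_span_le Ev; exact: leq_maxr.
Qed.

(** The vector u_i v is homogeneous of weight m + n - i - 1 < N, or zero if this number is
    negative. *)
Lemma bracket_word_span N : (forall k, (k < N)%N -> gr k `<=` word_span W k.+1) ->
  forall m n u v (i : nat), (m + n <= N)%N -> W m u -> W n v ->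
    word_span W (m + n) (mode u i%:Z v).
Proof.
move=> EN m n u v i mnN [m0 [_ gu]] [n0 [_ gv]].
have := grading_mode Hgr i%:Z gu gv.
case E: (_ - 1) => [k|k] /= => [guv|->]; last exact: subspace0 (word_span_subspace _ _).
by apply: (word_span_le _ (EN _ _ _ guv)); lia.
Qed.

Definition U_plus_C1 : set V := [set x | exists u c : V, [/\ U u, C1 gr c & x = u + c]].

Lemma gr_word_span : Vplus gr = U_plus_C1 -> forall n, gr n `<=` word_span W n.+1.
Proof.
move=> Vc n; have [N] := ubnP n; elim: N n => // N IH n; rewrite ltnS => nN.
have {}IH k : (k < n)%N -> gr k `<=` word_span W k.+1.
  by move=> kn; apply: IH; exact: leq_trans nN.
have E0 : gr 0%N `<=` word_span W 1.
  rewrite Hgr0 => _ [c _ <-]; apply: subspaceZ; first exact: word_span_subspace.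
  exact: word_span_vac.
case: n nN IH => [//|n] _ IH x gx.
(* The induction hypothesis controls brackets of total weight at most n + 1, so E obeys the
   filtration rules up to that weight. *)
have mode_le p q a b (j : int) : (p + q <= n.+1)%N -> word_span W p.+1 a ->
    word_span W q.+1 b -> word_span W (p + q).+1 (mode a j b).
  move=> pq Ea Eb.
  have := word_span_mode graded_part_gt0 (bracket_word_span IH) j pq Ea Eb.
  by apply: word_span_le; rewrite -addn1 leq_add2l leq_b1.
(* Decomposing x in U + C_1(V) produces components of all weights. Membership in E_k is demanded
   only for k <= n + 1, and [component_mem] then isolates weight n + 1. *)
pose A k := [set y | gr k y /\ ((k <= n.+1)%N -> word_span W k.+1 y)].
suff [_ Ex] : A n.+1 x by exact: Ex.
have sA k : is_subspace (A k).
  split; first by split=> [|_]; [exact: subspace0|exact: subspace0 (word_span_subspace _ _)].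
  move=> a u v [gu Eu] [gv Ev]; split; first by case: (gr_subspace k) => _; apply.
  by move=> kn; case: (word_span_subspace W k.+1) => _; apply; [exact: Eu|exact: Ev].
apply: (component_mem coV sA _ gx); first by move=> k y [].
have sT : is_subspace (lspan (\bigcup_k A k)) := lspan_subspace _.
have : Vplus gr x by exact: Vplus_gr gx.
rewrite Vc => -[u [c [Uu C1c ->]]]; apply: subspaceD => //.
  move: u Uu; rewrite U_span; apply: lspan_mono => u [k _ Wu]; exists k => //.
  by split=> [|_]; [case: Wu => _ []|exact: word_span_letter].
move: c C1c; apply: lspan_min => // _ [[a [b [Va Vb ->]]]|[w ->]].
- move: b Vb; apply: (lspan_min (S := mode a (-1) @^-1` lspan _)).
    exact: subspace_preimage (mode_linearr _ _) sT.
  move=> b [q /= q0 gb]; move: a Va.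
  apply: (lspan_min (S := (fun a => mode a (-1) b) @^-1` lspan _)).
    exact: subspace_preimage (mode_linearl _ _) sT.
  move=> a [p /= p0 ga]; apply: sub_lspan; exists (p + q)%N => //; split.
    by apply: gr_mode ga gb _; lia.
  (* Both p and q are positive, hence both are below n + 1. *)
  by move=> pqn; apply: mode_le => //; apply: IH => //; lia.
- move: w (V_sum w).
  apply: (lspan_min (S := (fun w => mode w (-2) vac) @^-1` lspan _)).
    exact: subspace_preimage (mode_linearl _ _) sT.
  move=> w [k _ gw]; apply: sub_lspan; exists k.+1 => //; split.
    by apply: gr_mode gw vac_gr _; lia.
  (* With w in E_k and the vacuum in E_0, w_(-2) 1 already lies in E_k. *)
  move=> kn; rewrite -(addn0 k); apply: (@word_span_le _ _ _ (k + 0).+1) => //.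
  by apply: mode_le; [lia|exact: IH|exact: word_span_vac].
Qed.

(** * From (a) to (b) and from (b) to (c) *)

Lemma bracket_of_weight_bound : generates_with_weight_bound gr U ->
  forall m n u v (i : nat), W m u -> W n v -> word_span W (m + n) (mode u i%:Z v).
Proof.
move=> [_ H] m n u v i Wu Wv.
have m0 := graded_part_gt0 Wu; have n0 := graded_part_gt0 Wv.
have := H m n u v i m0 n0 Wu Wv; rewrite weighted_spanE.
by apply: word_span_le; lia.
Qed.

Lemma strongly_generates_word_span :
  (forall x, exists n, word_span W n x) -> strongly_generates U.
Proof.
move=> Ex; apply/seteqP; split=> // x _; have [n] := Ex x.
apply: lspan_mono => _ [s [ws _] <-]; exists [seq p.1 | p <- s] => //.
by move=> p /mapP[q /ws[[_ [Uq _]] q1] ->].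
Qed.

Lemma weight_bound_strongly_generates :
  generates_with_weight_bound gr U -> strongly_generates U.
Proof.
move=> Ha; have WW := bracket_of_weight_bound Ha.
apply: strongly_generates_word_span => x.
have : [set: V] x by []; rewrite -Ha.1; move: x.
apply: lspan_min; first exact: word_span_union_subspace.
move=> _ [s sU <-]; elim: s sU => [_|[u j] s IH sU].
  by exists 1%N; exact: word_span_vac.
have [n En] : exists n, word_span W n (monomial s).
  by apply: IH => p ps; apply: sU; rewrite inE ps orbT.
have : U u by exact: (sU (u, j)) (mem_head _ _).
rewrite {1}U_span /=; move: u {sU IH}.
apply: (lspan_min (S := (fun u => mode u j _) @^-1` [set x | exists n, word_span W n x])).
  exact: subspace_preimage (mode_linearl _ _) word_span_union_subspace.
move=> u [m _ Wu]; exists (m + n + (j < 0)%R)%N.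
apply: (word_span_mode graded_part_gt0 (fun m n u v i _ => WW m n u v i) _ (leqnn _)).
  exact: word_span_letter.
exact: word_span_le En.
Qed.

(** A nonempty word u_(-k) s lies in U + C_1(V): if s = c 1 + y with y in V_+, then u_(-k) y is in
    C_1(V), while u_(-k) 1 is u for k = 1 and lies in C_1(V) for k >= 2. Only the empty word
    contributes a multiple of the vacuum. *)
Lemma strongly_generates_C1 : strongly_generates U -> Vplus gr = U_plus_C1.
Proof.
move=> Hb; have sT : is_subspace U_plus_C1.
  split.
    exists 0, 0; split; last by rewrite addr0.
      exact: subspace0.
    exact: subspace0 C1_subspace.
  move=> a _ _ [u [c [Uu Cc ->]]] [v [d [Uv Cd ->]]].
  exists (a *: u + v), (a *: c + d); split; last by rewrite scalerDr addrACA.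
    by case: U_subspace => _; apply.
  by case: C1_subspace => _; apply.
have UT u : U u -> U_plus_C1 u.
  by exists u, 0; rewrite addr0; split=> //; exact: subspace0 C1_subspace.
have CT c : C1 gr c -> U_plus_C1 c.
  by exists 0, c; rewrite add0r; split=> //; exact: subspace0.
have TV : U_plus_C1 `<=` Vplus gr.
  move=> _ [u [c [Uu Cc ->]]]; apply: subspaceD; first exact: Vplus_subspace.
    exact: HUplus.
  exact: C1_Vplus.
apply/seteqP; split=> // x Vx.
have [c [y [Ty xE]]] : exists c y, U_plus_C1 y /\ x = c *: vac + y.
  have : [set: V] x by []; rewrite -Hb; move: x {Vx}.
  apply: (lspan_min (S := [set x | exists c y, U_plus_C1 y /\ x = c *: vac + y])).
    split; first by exists 0, 0; rewrite scale0r addr0; split=> //; exact: subspace0.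
    move=> a _ _ [c [y [Ty ->]]] [d [z [Tz ->]]].
    exists (a * c + d), (a *: y + z); split; first by case: sT => _; apply.
    by rewrite scalerDl scalerDr scalerA addrACA.
  move=> _ [[|[u k] s] sU <-].
    by exists 1, 0; rewrite scale1r addr0; split=> //; exact: subspace0.
  have [/= Uu k1] := sU (u, k) (mem_head _ _).
  have [c [y [Vy sE]]] := vac_Vplus_decomposition (nmonomial s).
  exists 0, (mode u (- k%:Z) (nmonomial s)); rewrite scale0r add0r; split=> //.
  rewrite sE (mode_linearr u); case: k k1 {sU} => // k _.
  apply: subspaceD => //; last exact/CT/C1_mode/Vy/HUplus.
  apply: subspaceZ => //; case: k => [|k]; first by rewrite mode_creation; exact: UT.
  exact/CT/C1_mode_vac.
(* This multiple is x - y, which lies in both V_(0) and V_+. *)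
suff c0 : c *: (vac : V) = 0 by rewrite xE c0 add0r.
apply: Vplus_gr0; first by rewrite Hgr0; exists c.
rewrite -[c *: _](addrK y) -xE; apply: subspaceB Vx (TV _ Ty).
exact: Vplus_subspace.
Qed.

(** * Consequences of (c): the weight bound, the good filtration and PBW spanning *)

Lemma C1_word_span : Vplus gr = U_plus_C1 -> forall x, exists n, word_span W n x.
Proof.
move=> Hc x; move: x (V_sum x).
apply: lspan_min; first exact: word_span_union_subspace.
by move=> x [n _ gx]; exists n.+1; exact: gr_word_span gx.
Qed.

Lemma C1_bracket : Vplus gr = U_plus_C1 ->
  forall m n u v (i : nat), W m u -> W n v -> word_span W (m + n) (mode u i%:Z v).
Proof.
move=> Hc m n u v i; apply: (@bracket_word_span (m + n)%N) => // k _.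
exact: gr_word_span.
Qed.

Lemma C1_weight_bound : Vplus gr = U_plus_C1 -> generates_with_weight_bound gr U.
Proof.
move=> Hc; split.
  apply/seteqP; split=> // x _; have [n] := C1_word_span Hc x.
  apply: lspan_mono => _ [s [ws _] <-].
  exists [seq (p.1, - p.2%:Z) | p <- [seq p.1 | p <- s]] => //.
  by move=> p /mapP[_ /mapP[q /ws[[_ [Uq _]] q1] ->] ->].
move=> m n u v i m0 n0 Wu Wv; rewrite weighted_spanE subn1 prednK ?addn_gt0 ?m0 //.
exact: C1_bracket.
Qed.

Lemma C1_good_filtration : Vplus gr = U_plus_C1 -> good_filtration (EU gr U).
Proof.
move=> Hc; have WW := C1_bracket Hc.
have sE n : is_subspace (EU gr U n).
  by case: n => n; [rewrite EU_word_span; exact: word_span_subspace|exact: subspace_set0].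
have Emode (m n j : int) u v : EU gr U m u -> EU gr U n v ->
    EU gr U (if 0 <= j then m + n - 1 else m + n) (mode u j v).
  case: m => [p|p]; last by move=> -> _; rewrite mode0l; exact: subspace0.
  case: n => [q|q]; last by move=> _ ->; rewrite mode0r; exact: subspace0.
  rewrite !EU_word_span => Eu Ev.
  have := word_span_mode graded_part_gt0 (fun m n u v i _ => WW m n u v i) j
    (leqnn _) Eu Ev.
  have [_|_] := leP 0 j; last by rewrite addn1 -PoszD EU_word_span.
  (* For p + q = 0 the target is E_(-1) = 0; no word has weight below 0, so the vector is an empty
     sum. *)
  rewrite addn0; case E: (p + q)%N => [|d].
    case=> s [+ ->]; case: s => [_|r s /(_ _ (mem_head _ _))[t []//]].
    by rewrite big_nil; exact: subspace0.
  by rewrite -PoszD E (_ : d.+1%:Z - 1 = d%:Z) ?EU_word_span //; lia.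
split=> //.
- case=> [n|n x ->]; last exact: subspace0.
  by rewrite -PoszD !EU_word_span; apply: word_span_le; lia.
- apply/seteqP; split=> // x _; have [n En] := C1_word_span Hc x.
  by exists n%:Z => //; rewrite EU_word_span; exact: word_span_le En.
- by rewrite (EU_word_span 0); exact: word_span_vac.
- move=> m n j u v Eu Ev j0; have := Emode m n j u v Eu Ev.
  by rewrite leNgt j0.
- move=> m n j u v Eu Ev j0; have := Emode m n j u v Eu Ev.
  by rewrite j0.
Qed.

Lemma PBW_strongly_generates : generates_PBW U -> strongly_generates U.
Proof.
move=> [B [_ BU] H]; have [ge /H] := exists_total_order [set p : V * nat | B p.1 /\ (1 <= p.2)%N].
move=> E; apply/seteqP; split=> //; rewrite -E; apply: lspan_mono.
move=> _ [s [sB _] <-]; exists s => // p /sB[Bp p1]; split=> //.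
by rewrite -BU; exact: sub_lspan.
Qed.

Lemma C1_PBW : Vplus gr = U_plus_C1 -> generates_PBW U.
Proof.
move=> Hc; have WW := C1_bracket Hc.
(* The basis is taken among homogeneous vectors, so that each [W n] is spanned by the basis vectors
   it contains. *)
have [B [BW iB WB]] := exists_basis (\bigcup_n W n).
exists B.
  split=> //; rewrite U_span; apply/seteqP; split; apply: lspan_min => //.
  - exact: lspan_subspace.
  - by move=> b /BW; exact: sub_lspan.
  - exact: lspan_subspace.
pose WB' n := W n `&` B.
have WWB m u : W m u -> lspan (WB' m) u.
  move=> Wu; apply: (component_mem (A := fun k => lspan (WB' k)) coV).
  - by move=> k; exact: lspan_subspace.
  - by move=> k; apply: lspan_min => // v [[_ []]].
  - by case: Wu => _ [].
  have : lspan B u by apply: WB; exists m.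
  apply: lspan_min; first exact: lspan_subspace.
  move=> b Bb; have [k _ Wb] := BW _ Bb.
  by apply: sub_lspan; exists k => //; exact: sub_lspan.
move=> D ge [totge _ _]; apply/seteqP; split=> // x _.
have [n En] := C1_word_span Hc x; move: x En.
elim: n => [|n IH].
  apply: (lspan_min (lspan_subspace _)) => x [s [_ +] _]; by rewrite ltn0.
move=> x /(word_span_letters WWB); move: x.
apply: (lspan_min (lspan_subspace _)) => _ [s [ws sn] <-].
(* Sorting changes the word by a vector of lower degree, which the induction on n already places in
   the span. *)
pose t := sort (relpre fst ge) s.
have st : perm_eq s t by rewrite perm_sym; apply/permPl/perm_sort.
have wsW : is_word W s by move=> p /ws[[]].
rewrite -[nmonomial _](subrK (nmonomial [seq p.1 | p <- t])).
apply: subspaceD; first exact: lspan_subspace.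
  apply/IH; apply: (@word_span_le _ _ _ (\sum_(p <- s) p.2)) => //.
  exact: word_span_perm graded_part_gt0 WW s t st wsW.
apply: sub_lspan; exists [seq p.1 | p <- t] => //; split.
  by move=> _ /mapP[q + ->]; rewrite -(perm_mem st) => /ws[[]].
rewrite sorted_map.
apply: (@sort_sorted_in _ [pred p | p.1 \in D]) => [p q pD qD|].
  exact: totge.
by apply/allP => p /ws[[_ Bp] p1]; rewrite inE /= inE; split.
Qed.

End Equivalences.

Theorem theorem4p11 (R : realType) (V : vertexAlgebra R) (gr : nat -> set V)
    (Hgr : is_grading gr)
    (Hgr0 : gr 0%N = [set c *: (vac : V) | c in [set: R[i]]])
    (U : set V) (HUgr : graded_subspace gr U) (HUplus : U `<=` Vplus gr) :
  [<-> generates_with_weight_bound gr U;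
       strongly_generates U;
       Vplus gr = [set x | exists u c : V, [/\ U u, C1 gr c & x = u + c]];
       generates_PBW U]
  /\
  (generates_with_weight_bound gr U \/ strongly_generates U \/
   Vplus gr = [set x | exists u c : V, [/\ U u, C1 gr c & x = u + c]] \/
   generates_PBW U ->
   good_filtration (EU gr U) /\
   forall n : nat,
     lspan (\bigcup_(k in [set k | (k <= n)%N]) gr k) `<=` EU gr U n%:Z).
Proof.
have ab := weight_bound_strongly_generates Hgr HUgr HUplus.
have bc := strongly_generates_C1 Hgr Hgr0 HUgr HUplus.
have db := @PBW_strongly_generates R V U.
split.
  split=> //; split=> //; split; first exact: C1_PBW.
  (* The cycle closes from (d) to (a) through (b) and (c). *)
  by move=> /db /bc; exact: C1_weight_bound.
move=> H; have Hc : Vplus gr = U_plus_C1 gr U.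
  by case: H => [/ab /bc|[/bc|[|/db /bc]]].
split=> [|n]; first exact: C1_good_filtration.
rewrite EU_word_span //; apply: lspan_min; first exact: word_span_subspace.
move=> x [k /= kn gx].
by apply: (@word_span_le _ _ _ k.+1) => //; exact: gr_word_span gx.
Qed.
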